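(* Let $p$ be a prime, let $(\alpha_j,\delta_j)\in\mathbb{C}_p\times(\mathbb{Q}\cup\{\infty\})$, $j=1,\dots,m$, be admissible pairs, and suppose $R=\bigcap_{j=1}^m\mathbb{Z}_{(p),\alpha_j,\delta_j}\cap\mathbb{Q}[X]$ is a Krull domain. Let $q\in\mathbb{Q}[X]$ be irreducible and $Q=q\mathbb{Q}[X]\cap R$. Then $Q$ is a maximal ideal of $R$ if and only if $q$ has no root in $\bigcup_{j=1}^m\bar B_p(\alpha_j,\delta_j)$.
   Context: Fix a prime $p$. $\overline{\mathbb{Q}_p}$ is an algebraic closure of $\mathbb{Q}_p$, $v_p$ the unique extension of the $p$-adic valuation, $\mathbb{C}_p$ the completion of $\overline{\mathbb{Q}_p}$. A pair $(\alpha,\delta)\in\mathbb{C}_p\times(\mathbb{Q}\cup\{\infty\})$ is admissible if: when $\delta\in\mathbb{Q}$, $\alpha\in\overline{\mathbb{Q}_p}$; when $\delta=\infty$, $\alpha$ is transcendental over $\mathbb{Q}$. For $\delta\in\mathbb{Q}$, $v_{p,\alpha,\delta}$ is the monomial valuation on $\mathbb{C}_p(X)$ given on polynomials by $v_{p,\alpha,\delta}(\sum_i a_i(X-\alpha)^i)=\min_i\{v_p(a_i)+i\delta\}$; for $\delta=\infty$, $v_{p,\alpha,\infty}(\varphi)=v_p(\varphi(\alpha))$ for $\varphi\in\mathbb{Q}(X)$. $\mathbb{Z}_{(p),\alpha,\delta}=\{\varphi\in\mathbb{Q}(X):v_{p,\alpha,\delta}(\varphi)\ge0\}$. $\bar B_p(\alpha,\delta)=\{x\in\mathbb{C}_p:v_p(x-\alpha)\ge\delta\}$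 (equal to $\{\alpha\}$ if $\delta=\infty$). Roots of $q$ are taken in $\mathbb{C}_p$. *)

(* Defs.v *)
From HB Require Import structures.
From mathcomp Require Import all_boot all_order all_algebra.
Set Implicit Arguments. Unset Strict Implicit. Unset Printing Implicit Defensive.
Import Order.TTheory GRing.Theory Num.Theory.
Local Open Scope ring_scope.

(* Values in G ∪ {∞}: [Some g] is the finite value g, [None] is ∞. *)
Definition vle {G : numDomainType} (a b : option G) : bool :=
  match a, b with
  | _, None => true
  | None, Some _ => false
  | Some x, Some y => x <= y
  end.
Definition vadd {G : numDomainType} (a b : option G) : option G :=
  match a, b with Some x, Some y => Some (x + y) | _, _ => None end.
Definition vmin {G : numDomainType} (a b : option G) : option G :=
  if vle a b then a else b.

Definition padic_val (p : nat) (r : rat) : rat :=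
  ((Posz (logn p (absz (numq r)))) - (Posz (logn p (absz (denq r)))))%:~R.

Definition is_valuation {G : numDomainType} (F : fieldType) (v : F -> option G) : Prop :=
  [/\ (forall x, v x = None <-> x = 0),
      (forall x y, v (x * y) = vadd (v x) (v y)) &
      (forall x y, vle (vmin (v x) (v y)) (v (x + y)))].

Definition algebraic_over_Q (F : fieldType) (x : F) : Prop :=
  exists P : {poly rat}, P != 0 /\ root (map_poly ratr P) x.

(* Characterization of (C, v) as C_p with its valuation v_p (unique up to
   isometric isomorphism): an algebraically closed field with a valuation
   extending v_p on Q, complete, in which the algebraic numbers are dense. *)
Definition IsCp (p : nat) (C : closedFieldType) (v : C -> option rat) : Prop :=
  [/\ is_valuation v,
      (forall r : rat, r != 0 -> v (ratr r) = Some (padic_val p r)),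
      (forall u : nat -> C,
          (forall N : rat, exists n0, forall m n, (n0 <= m)%N -> (n0 <= n)%N ->
               vle (Some N) (v (u m - u n))) ->
          exists l, forall N : rat, exists n0, forall n, (n0 <= n)%N ->
               vle (Some N) (v (u n - l))) &
      (forall (x : C) (N : rat), exists y, algebraic_over_Q y /\ vle (Some N) (v (x - y)))].

Definition In_Qp (C : closedFieldType) (v : C -> option rat) (x : C) : Prop :=
  forall N : rat, exists r : rat, vle (Some N) (v (x - ratr r)).

Definition In_Qpbar (C : closedFieldType) (v : C -> option rat) (x : C) : Prop :=
  exists P : {poly C}, P != 0 /\ (forall i, In_Qp v P`_i) /\ root P x.

(* delta = None encodes delta = ∞ *)
Definition admissible (C : closedFieldType) (v : C -> option rat)
  (alpha : C) (delta : option rat) : Prop :=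
  match delta with
  | Some _ => In_Qpbar v alpha
  | None => ~ algebraic_over_Q alpha
  end.

(* phi ∈ Z_{(p),alpha,delta} ∩ Q[X], i.e. v_{p,alpha,delta}(phi) >= 0.
   For delta finite, the coefficients a_i of phi = sum a_i (X - alpha)^i are
   the coefficients of phi(X + alpha). *)
Definition in_Z_ad (C : closedFieldType) (v : C -> option rat)
  (alpha : C) (delta : option rat) (phi : {poly rat}) : Prop :=
  match delta with
  | Some d => forall i : nat,
      vle (Some 0) (vadd (v ((map_poly ratr phi \Po ('X + alpha%:P))`_i)) (Some (i%:R * d)))
  | None => vle (Some 0) (v (map_poly ratr phi).[alpha])
  end.

Definition in_ball (C : closedFieldType) (v : C -> option rat)
  (alpha : C) (delta : option rat) (x : C) : Prop :=
  match delta with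
  | Some d => vle (Some d) (v (x - alpha))
  | None => x = alpha
  end.

Definition is_ideal_of (R J : {poly rat} -> Prop) : Prop :=
  [/\ (forall x, J x -> R x), J 0,
      (forall x y, J x -> J y -> J (x + y)),
      (forall x, J x -> J (- x)) &
      (forall r x, R r -> J x -> J (r * x))].

Definition maximal_ideal_of (R Q : {poly rat} -> Prop) : Prop :=
  [/\ is_ideal_of R Q,
      (exists r, R r /\ ~ Q r) &
      (forall J, is_ideal_of R J -> (forall x, Q x -> J x) ->
          (forall x, J x -> Q x) \/ (forall x, R x -> J x))].

(* Krull domain: a subring R of Q[X], with fraction field K inside Q(X),
   such that R = ∩_i V_i for a family of discrete valuation rings of K
   (given by normalized discrete valuations w_i on K) with finite character. *)
Fixpoint lin {I : Type} (i : I) (s : seq I) : Prop :=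
  match s with [::] => False | j :: s' => j = i \/ lin i s' end.

Definition frac_of (R : {poly rat} -> Prop) (x : {fraction {poly rat}}) : Prop :=
  exists a b, R a /\ R b /\ b != 0 /\ x = tofrac a / tofrac b.

Definition KrullDomain (R : {poly rat} -> Prop) : Prop :=
  exists (I : Type) (w : I -> {fraction {poly rat}} -> option int),
    [/\ (forall i, [/\ (forall x, frac_of R x -> (w i x = None <-> x = 0)),
                     (forall x y, frac_of R x -> frac_of R y ->
                         w i (x * y) = vadd (w i x) (w i y)),
                     (forall x y, frac_of R x -> frac_of R y ->
                         vle (vmin (w i x) (w i y)) (w i (x + y))) &
                     (exists x, frac_of R x /\ w i x = Some 1)]),
        (forall x, frac_of R x ->
           ((exists a, R a /\ x = tofrac a) <-> (forall i, vle (Some 0) (w i x)))) &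
        (forall x, frac_of R x -> x != 0 ->
           exists s : list I, forall i, w i x <> Some 0 -> lin i s)].

Definition R_of (C : closedFieldType) (v : C -> option rat) (m : nat)
  (alpha : 'I_m -> C) (delta : 'I_m -> option rat) (phi : {poly rat}) : Prop :=
  forall j, in_Z_ad v (alpha j) (delta j) phi.

(* Main.v *)
Require Import Defs.
From HB Require Import structures.
From mathcomp Require Import all_boot all_order all_algebra.
From mathcomp Require Import ring lra.
From Stdlib Require Import Classical.
Import Order.TTheory GRing.Theory Num.Theory.
Local Open Scope ring_scope.
Set Implicit Arguments. Unset Strict Implicit. Unset Printing Implicit Defensive.

(** If q has a root x in some ball, then {phi in R : v(phi(x)) > 0} is an ideal
    strictly between Q and R, since it contains p.

    Conversely, since every element of Q[X] has a p-power multiple in R, the ideal Q is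
    maximal as soon as p is invertible modulo Q, i.e. as soon as some multiple g of q
    in Q[X] satisfies v_j(g - 1) >= 1 for all j (an arithmetic Runge theorem: no Galois
    action, no completeness and no Krull property is involved).  A polynomial F without
    root in a ball is F(alpha) times a 1-unit there; as the residue field of C_p is
    algebraic over F_p, some c F^N with c a rational number is as close to 1 as wanted.
    For several balls, let f_j in Q[X] be of minimal degree among the nonzero
    polynomials with a root in the ball j.  All the roots of f_j then induce the same
    valuation on Q[X], so that after discarding redundant balls f_j has no root in the
    other balls and is strictly larger (in valuation) on the ball j.  Products of
    powers of the f_j yield a ball i and a polynomial U without root in it whose
    valuation is strictly minimal on this ball; for large s a multiple T = c (q U^s)^N
    is then close to 1 on the ball i and integral on the others, and if g' is a
    solution for the other balls, 1 - (1 - g')(1 - T) is a solution for all balls. *)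

(** [G c x] reads: the value of x is at least c. Keeping only this predicate avoids minima and
    infinite values, and treats Gauss valuations and evaluations uniformly. *)
Record filtration (A : comNzRingType) (G : rat -> A -> Prop) : Prop := Filtration {
  filW : forall c d x, c <= d -> G d x -> G c x;
  fil0 : forall c, G c 0;
  fil1 : G 0 1;
  filN : forall c x, G c x -> G c (- x);
  filD : forall c x y, G c x -> G c y -> G c (x + y);
  filM : forall c d x y, G c x -> G d y -> G (c + d) (x * y) }.

Lemma rat_archi (x : rat) : exists n, forall k, (n <= k)%N -> x < k%:R.
Proof.
exists (Num.bound `|x|) => k le_k; apply: le_lt_trans (ler_norm x) _.
by apply: lt_le_trans (archi_boundP (normr_ge0 x)) _; rewrite ler_nat.
Qed.

(** * Powers of 1-units in a filtered ring *)

Section FiltrationTheory.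
Variables (A : comNzRingType) (G : rat -> A -> Prop).
Hypothesis GF : filtration G.

Lemma filB c x y : G c x -> G c y -> G c (x - y).
Proof. by move=> Gx Gy; apply: filD => //; apply: filN. Qed.

Lemma filX c x n : G c x -> G (n%:R * c) (x ^+ n).
Proof.
move=> Gx; elim: n => [|n IHn]; first by rewrite mul0r; apply: fil1.
by rewrite exprS -natr1 mulrDl mul1r addrC; apply: filM.
Qed.

Lemma filX0 x n : G 0 x -> G 0 (x ^+ n).
Proof. by move/(filX n); rewrite mulr0. Qed.

Lemma fil_sum (I : Type) (r : seq I) (P : pred I) (F : I -> A) c :
  (forall i, P i -> G c (F i)) -> G c (\sum_(i <- r | P i) F i).
Proof.
by move=> H; apply: big_ind => //; [apply: fil0 | move=> *; apply: filD].
Qed.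

Lemma fil_nat n : G 0 n%:R.
Proof.
by elim: n => [|n IHn]; [apply: fil0 | rewrite -natr1; apply: filD => //; apply: fil1].
Qed.

Lemma fil_int (k : int) : G 0 k%:~R.
Proof.
by case: k => n; rewrite ?NegzE ?mulrNz; [| apply: filN => //]; apply: fil_nat.
Qed.

Lemma fil_unit e x : 0 < e -> G e (x - 1) -> G 0 x.
Proof.
move=> e0 Gx; rewrite -(subrK 1 x); apply: filD => //; last exact: fil1.
by apply: filW Gx => //; apply: ltW.
Qed.

Lemma filM1 e x y : 0 < e -> G e (x - 1) -> G e (y - 1) -> G e (x * y - 1).
Proof.
move=> e0 Gx Gy; have -> : x * y - 1 = (x - 1) * y + (y - 1) by ring.
apply: filD => //; rewrite -(addr0 e); apply: filM => //; exact: fil_unit Gy.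
Qed.

Lemma filX1 e x n : 0 < e -> G e (x - 1) -> G e (x ^+ n - 1).
Proof.
move=> e0 Gx; elim: n => [|n IHn]; first by rewrite subrr; apply: fil0.
by rewrite exprS; apply: filM1.
Qed.

(** In x^p - 1 = (x - 1)(1 + x + ... + x^(p-1)) the second factor is p plus the terms x^i - 1, so it
    has value at least e. *)
Lemma filXp (p : nat) e e' x : G 1 p%:R -> 0 < e -> e <= 1 -> e <= e' ->
  G e' (x - 1) -> G (e' + e) (x ^+ p - 1).
Proof.
move=> Gp e0 e1 ee Gx; rewrite subrX1; apply: filM => //.
have -> : \sum_(i < p) x ^+ i = \sum_(i < p) (x ^+ i - 1) + p%:R.
  by rewrite sumrB sumr_const card_ord subrK.
apply: filD => //; last exact: filW Gp.
by apply: fil_sum => i _; apply: filX1 => //; apply: filW Gx.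
Qed.

Lemma filXpn (p : nat) e x M : G 1 p%:R -> 0 < e -> G e (x - 1) ->
  exists t, G M (x ^+ (p ^ t) - 1).
Proof.
(* Each p-th power gains [e1], capped at 1 because of the bound on p, so the precision grows
   linearly in t. *)
move=> Gp e0 Gx; pose e1 := Num.min e 1.
have e1_gt0 : 0 < e1 by rewrite lt_min e0 ltr01.
have e1_le1 : e1 <= 1 by rewrite ge_min lexx orbT.
have e1_lee : e1 <= e by rewrite ge_min lexx.
have H t : G (t.+1%:R * e1) (x ^+ (p ^ t) - 1).
  elim: t => [|t IHt]; first by rewrite mul1r; apply: filW Gx.
  rewrite -natr1 mulrDl mul1r expnSr exprM; apply: filXp => //.
  by rewrite ler_peMl ?ler1n // ltW.
have [n Hn] := rat_archi (M / e1); exists n; apply: filW (H _) => //.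
by rewrite -ler_pdivrMr // ltW // Hn.
Qed.

End FiltrationTheory.

(** * Gauss valuations in which X has value d *)

Section Gauss.
Variables (A : comNzRingType) (G : rat -> A -> Prop) (d : rat).
Hypothesis GF : filtration G.

Definition gauss (c : rat) (h : {poly A}) : Prop :=
  forall i : nat, G (c - i%:R * d) h`_i.

Lemma gauss_filtration : filtration gauss.
Proof.
split.
- by move=> c c' h le_cc' Gh i; apply: filW (Gh i) => //; rewrite lerB.
- by move=> c i; rewrite coef0; apply: fil0.
- case=> [|i]; rewrite coef1; last exact: fil0.
  by rewrite mul0r subr0; apply: fil1.
- by move=> c h Gh i; rewrite coefN; apply: filN.
- by move=> c h k Gh Gk i; rewrite coefD; apply: filD.
- move=> c c' h k Gh Gk i; rewrite coefM; apply: fil_sum => // j _.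
  have -> : c + c' - i%:R * d = (c - j%:R * d) + (c' - (i - j)%:R * d).
    by rewrite natrB -1?ltnS //; ring.
  exact: filM.
Qed.

Lemma gaussC c a : G c a -> gauss c a%:P.
Proof.
move=> Ga [|i]; rewrite coefC /=; last exact: fil0.
by rewrite mul0r subr0.
Qed.

End Gauss.

Lemma filtration_comp (A B : comNzRingType) (f : {rmorphism A -> B}) G :
  filtration G -> filtration (fun c x => G c (f x)).
Proof.
move=> GF; split=> [c d x|c||c x|c x y|c d x y].
- exact: filW.
- by rewrite rmorph0; apply: fil0.
- by rewrite rmorph1; apply: fil1.
- by rewrite rmorphN; apply: filN.
- by rewrite rmorphD; apply: filD.
- by rewrite rmorphM; apply: filM.
Qed.

(** Taylor coefficients are values of Hasse derivatives. For rational f these are again rational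
    polynomials, so a bound centred at a depends only on the valuation that a induces on Q[X]. *)
Lemma coef_comp_XaddC (A : comNzRingType) (f : {poly A}) (a : A) (i : nat) :
  (f \Po ('X + a%:P))`_i = f^`N(i).[a].
Proof.
rewrite /comp_poly addrC nderiv_taylor; last exact: mulrC.
rewrite (eq_bigr (fun j : 'I_(size f^:P) => f^`N(j).[a] *: 'X^j)).
  rewrite -(poly_def _ (fun j => f^`N(j).[a])) coef_poly.
  case: ltnP => // le_fi; rewrite nderivn_poly0 ?horner0 //.
  by apply: leq_trans le_fi; rewrite size_map_polyC.
by move=> j _; rewrite nderivn_map horner_map -mul_polyC.
Qed.

Lemma seq_argmax (T : eqType) (s : seq T) (f : T -> rat) : s != [::] ->
  exists2 x, x \in s & forall y, y \in s -> f y <= f x.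
Proof.
elim: s => // x s IHs _; have [->|/IHs[y ys Hy]] := eqVneq s [::].
  by exists x => [|y]; rewrite inE // => /eqP->.
have [le_yx | /ltW le_xy] := lerP (f y) (f x).
  exists x => [|z]; rewrite inE ?eqxx // => /predU1P[->|/Hy le_zy] //.
  exact: le_trans le_yx.
by exists y => [|z]; rewrite inE ?ys ?orbT // => /predU1P[->|/Hy].
Qed.

Lemma eventually_all (T : finType) (P : T -> nat -> Prop) :
  (forall t, exists n, forall k, (n <= k)%N -> P t k) ->
  exists n, forall t, P t n.
Proof.
move=> /fin_all_exists[n Hn]; exists (\max_t n t) => t.
by apply: Hn; apply: leq_bigmax.
Qed.

(** * Valuations on C, balls, and polynomials without root in a ball *)

Section Valuation.
Variables (C : closedFieldType) (v : C -> option rat).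
Hypothesis vV : is_valuation v.

Definition vge (c : rat) (x : C) : Prop := vle (Some c) (v x).
(* Junk value: [vfin 0 = 0]. *)
Definition vfin (x : C) : rat := odflt 0 (v x).

Lemma vge_vle c x : vge c x = vle (Some c) (v x). Proof. by []. Qed.

Lemma vfinE x : vfin x = odflt 0 (v x). Proof. by []. Qed.

Lemma v_some x : x != 0 -> v x = Some (vfin x).
Proof.
case: vV => v0 _ _ x0; rewrite /vfin; case: (v x) (v0 x) => //= -[/(_ erefl)].
by move/eqP: x0.
Qed.

Lemma vgeE c x : x != 0 -> vge c x <-> c <= vfin x.
Proof. by move=> x0; rewrite /vge v_some. Qed.

Lemma vge0 c : vge c 0.
Proof. by case: vV => v0 _ _; rewrite /vge (v0 0).2. Qed.

Lemma vfinM x y : x != 0 -> y != 0 -> vfin (x * y) = vfin x + vfin y.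
Proof.
case: vV => _ vM _ x0 y0; have := vM x y.
by rewrite !v_some ?mulf_neq0 // => -[].
Qed.

Lemma vfin1 : vfin 1 = 0.
Proof. by have := vfinM (oner_neq0 C) (oner_neq0 C); rewrite mulr1 => H; lra. Qed.

Lemma vfinN x : vfin (- x) = vfin x.
Proof.
have [->|x0] := eqVneq x 0; first by rewrite oppr0.
have N1 : (-1 : C) != 0 by rewrite oppr_eq0 oner_neq0.
have := vfinM N1 N1; rewrite mulrNN mulr1 vfin1 -(mulN1r x) vfinM // => H.
by rewrite (_ : vfin (-1) = 0) ?add0r //; lra.
Qed.

Lemma vge_filtration : filtration vge.
Proof.
split.
- move=> c d x le_cd; have [->|x0] := eqVneq x 0; first by move=> _; apply: vge0.
  by move=> /(vgeE _ x0) le_dx; apply/(vgeE _ x0); exact: (le_trans le_cd le_dx).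
- exact: vge0.
- by apply/vgeE; rewrite ?oner_neq0 ?vfin1.
- move=> c x; have [->|x0] := eqVneq x 0; first by rewrite oppr0.
  by move=> /(vgeE _ x0) H; apply/vgeE; rewrite ?oppr_eq0 ?vfinN.
- case: vV => _ _ vD c x y; rewrite /vge /vmin => Hx Hy; have := vD x y.
  rewrite /vmin; case: ifP => _.
    by case: (v x) Hx => [a|] /= ca; case: (v (x + y)) => //= b; apply: le_trans.
  by case: (v y) Hy => [a|] /= ca; case: (v (x + y)) => //= b; apply: le_trans.
- move=> c d x y.
  have [->|x0] := eqVneq x 0; first by rewrite mul0r => _ _; apply: vge0.
  have [->|y0] := eqVneq y 0; first by rewrite mulr0 => _ _; apply: vge0.
  move=> /(vgeE _ x0) Hx /(vgeE _ y0) Hy; apply/vgeE; first by rewrite mulf_neq0.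
  by rewrite vfinM // lerD.
Qed.
Let vF := vge_filtration.

Lemma vge_val x : vge (vfin x) x.
Proof.
have [->|x0] := eqVneq x 0; first exact: vge0.
by apply/vgeE.
Qed.

Lemma vfinX x n : x != 0 -> vfin (x ^+ n) = n%:R * vfin x.
Proof.
move=> x0; elim: n => [|n IHn]; first by rewrite vfin1 mul0r.
by rewrite exprS vfinM ?expf_neq0 // IHn -natr1; ring.
Qed.

Lemma vfinV x : x != 0 -> vfin x^-1 = - vfin x.
Proof.
by move=> x0; have := vfinM x0 (invr_neq0 x0); rewrite mulfV // vfin1 => H; lra.
Qed.

Lemma vfinXz x (k : int) : x != 0 -> vfin (x ^ k) = k%:~R * vfin x.
Proof.
move=> x0; case: k => n; first exact: vfinX.
by rewrite NegzE -exprnN vfinV ?expf_neq0 // vfinX // mulrNz mulNr.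
Qed.

Lemma val_unit e x : 0 < e -> vge e (x - 1) -> x != 0 /\ vfin x = 0.
Proof.
move=> e0 Hx; have x0 : x != 0.
  apply/eqP => x0; move: Hx; rewrite x0 sub0r.
  have N1 : (-1 : C) != 0 by rewrite oppr_eq0 oner_neq0.
  by move=> /(vgeE _ N1); rewrite vfinN vfin1 leNgt e0.
split=> //; apply/eqP; rewrite eq_le; apply/andP; split; last first.
  by apply/(vgeE _ x0); exact: (fil_unit vF e0 Hx).
(* If x had positive value, so would 1 = x - (x - 1). *)
rewrite leNgt; apply/negP => vx0; pose e1 := Num.min e (vfin x).
have e1_gt0 : 0 < e1 by rewrite lt_min e0.
have /(vgeE _ (oner_neq0 C)) : vge e1 1.
  have -> : (1 : C) = x - (x - 1) by ring.
  apply: filB => //; last by apply: filW Hx => //; rewrite ge_min lexx.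
  by apply/vgeE => //; rewrite ge_min lexx orbT.
by rewrite vfin1 leNgt e1_gt0.
Qed.

(* [v_{p,a,d}(F) >= c] in the notation of the paper. *)
Definition ge (a : C) (d c : rat) (F : {poly C}) : Prop :=
  gauss vge d c (F \Po ('X + a%:P)).

Lemma ge_filtration a d : filtration (ge a d).
Proof. exact: (filtration_comp (comp_poly ('X + a%:P)) (gauss_filtration d vF)). Qed.
Let gF := ge_filtration.

Lemma geC a d c z : vge c z -> ge a d c z%:P.
Proof. by move=> Hz; rewrite /ge comp_polyC; apply: gaussC. Qed.

Lemma geZ a d c c' z F : vge c z -> ge a d c' F -> ge a d (c + c') (z *: F).
Proof. by move=> Hz HF; rewrite -mul_polyC; apply: (filM (gF a d)) => //; apply: geC. Qed.

Lemma ge_XsubC a d c b : c <= d -> vge c (a - b) -> ge a d c ('X - b%:P).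
Proof.
move=> le_cd Hab; rewrite /ge comp_polyB comp_polyX comp_polyC -addrA -polyCB.
move=> [|[|i]]; rewrite coefD coefX coefC /= ?mul0r ?subr0 ?add0r ?addr0 //.
  by rewrite mul1r; apply: filW (fil1 vF) => //; rewrite subr_le0.
exact: vge0.
Qed.

Lemma Taylor_expansion (F : {poly C}) a :
  F = \sum_(i < size (F \Po ('X + a%:P)))
         (F \Po ('X + a%:P))`_i *: ('X - a%:P) ^+ i.
Proof. by rewrite -{1}[F](comp_polyXaddC_K _ a) comp_polyE. Qed.

(** The ball (b, d') lies in the ball (a, d), so X - a has value at least d there; apply this to the
    expansion at a. *)
Lemma ge_change a b d d' c F :
  d <= d' -> vge d (b - a) -> ge a d c F -> ge b d' c F.
Proof.
move=> le_dd' Hab HF; rewrite [F](Taylor_expansion F a).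
apply: (fil_sum (gF b d')) => i _; rewrite -(subrK (i%:R * d) c); apply: geZ => //.
by apply: (filX (gF b d')); apply: ge_XsubC.
Qed.

Lemma ge_horner a d c F x : ge a d c F -> vge d (x - a) -> vge c F.[x].
Proof.
move=> HF Hx; rewrite [F](Taylor_expansion F a) horner_sum.
apply: (fil_sum vF) => i _; rewrite hornerZ horner_exp hornerXsubC.
by rewrite -(subrK (i%:R * d) c); apply: (filM vF) => //; apply: (filX vF).
Qed.

Lemma ge_exists a d F : exists c, ge a d c F.
Proof.
elim/poly_ind: F => [|F z [c Hc]]; first by exists 0; apply: (fil0 (gF a d)).
pose b := Num.min d (vfin a).
have HX : ge a d b 'X.
  rewrite -['X]subr0 -polyC0; apply: ge_XsubC; rewrite ?ge_min ?lexx //.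
  by apply: (filW vF _ (vge_val _)); rewrite subr0 ge_min lexx orbT.
exists (Num.min (c + b) (vfin z)); apply: (filD (gF a d)).
  by apply: (filW (gF a d) _ (filM (gF a d) Hc HX)); rewrite ge_min lexx.
by apply: (filW (gF a d) _ (geC a d (vge_val z))); rewrite ge_min lexx orbT.
Qed.

(** Passing to a larger ball costs at most i(d - d') on the coefficient of degree i < n. *)
Lemma ge_enlarge a d d' c (F : {poly C}) n : d' <= d -> (size F <= n)%N ->
  ge a d c F -> ge a d' (c - n%:R * (d - d')) F.
Proof.
move=> le_d Fn HF i; have [lt_in | le_ni] := ltnP i n; last first.
  by rewrite nth_default ?size_comp_poly2 ?size_XaddC ?(leq_trans Fn) //; apply: vge0.
apply: (filW vF _ (HF i)).
have : i%:R * (d - d') <= n%:R * (d - d').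
  by rewrite ler_wpM2r ?subr_ge0 // ler_nat ltnW.
lra.
Qed.

(** On the ball, F is the constant F(a) times a 1-unit for the Gauss valuation. *)
Definition near (a : C) (d : rat) (F : {poly C}) : Prop :=
  F.[a] != 0 /\ exists2 e, 0 < e & ge a d e (F.[a]^-1 *: F - 1).

Lemma near_ge a d F : near a d F -> ge a d (vfin F.[a]) F.
Proof.
move=> [Fa0 [e e0 He]]; rewrite -[F in ge _ _ _ F](scalerKV Fa0).
by rewrite -[vfin _]addr0; apply: geZ; [apply: vge_val | apply: (fil_unit (gF a d) e0 He)].
Qed.

Lemma nearM a d F H : near a d F -> near a d H -> near a d (F * H).
Proof.
move=> [Fa0 [e e0 He]] [Ha0 [e' e'0 He']].
split; first by rewrite hornerM mulf_neq0.
exists (Num.min e e'); first by rewrite lt_min e0.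
have -> : (F * H).[a]^-1 *: (F * H) = (F.[a]^-1 *: F) * (H.[a]^-1 *: H).
  by rewrite hornerM invfM -scalerA -scalerAl -scalerAr.
apply: (filM1 (gF a d)); rewrite ?lt_min ?e0 //.
  by apply: (filW (gF a d) _ He); rewrite ge_min lexx.
by apply: (filW (gF a d) _ He'); rewrite ge_min lexx orbT.
Qed.

Lemma nearC a d z : z != 0 -> near a d z%:P.
Proof.
move=> z0; split; first by rewrite hornerC.
by exists 1 => //; rewrite hornerC -mul_polyC -polyCM mulVf // subrr; apply: (fil0 (gF a d)).
Qed.

Lemma nearX a d F n : near a d F -> near a d (F ^+ n).
Proof.
move=> HF; elim: n => [|n IHn]; first by apply: nearC; rewrite oner_neq0.
by rewrite exprS; apply: nearM.
Qed.

(** Here (X - z)/(a - z) = 1 + (X - a)/(a - z), whose last term has value d - v(a - z) > 0 as z is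
    outside the ball. *)
Lemma near_XsubC a d z : ~ vge d (z - a) -> near a d ('X - z%:P).
Proof.
move=> Hz; have az : a - z != 0.
  by rewrite subr_eq0; apply/eqP => az; apply: Hz; rewrite az subrr; apply: vge0.
have lt_d : vfin (a - z) < d.
  rewrite ltNge; apply/negP => le_d; apply: Hz.
  by rewrite -opprB; apply: (filN vF); apply/vgeE.
split; first by rewrite hornerXsubC.
exists (d - vfin (a - z)); first by rewrite subr_gt0.
rewrite hornerXsubC.
have -> : (a - z)^-1 *: ('X - z%:P) - 1 = (a - z)^-1 *: ('X - a%:P) :> {poly C}.
  have -> : 'X - z%:P = ('X - a%:P) + (a - z)%:P by rewrite polyCB; ring.
  by rewrite scalerDr -[_ *: (a - z)%:P]mul_polyC -polyCM mulVf // addrK.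
rewrite addrC; apply: geZ; first by rewrite -vfinV //; apply: vge_val.
by apply: ge_XsubC => //; rewrite subrr; apply: vge0.
Qed.

Lemma near_no_root a d F : F != 0 ->
  (forall z, root F z -> ~ vge d (z - a)) -> near a d F.
Proof.
have [r ->] := closed_field_poly_normal F; set k := lead_coef F => F0 Hr.
have k0 : k != 0 by apply: contraNneq F0 => ->; rewrite scale0r.
have {F0}Hr z : z \in r -> ~ vge d (z - a).
  by move=> zr; apply: Hr; rewrite rootZ // root_prod_XsubC.
rewrite -mul_polyC; apply: nearM; first exact: nearC.
elim: r Hr => [|z r IHr] Hr.
  by rewrite big_nil; apply: nearC; rewrite oner_neq0.
rewrite big_cons; apply: nearM; first by apply: near_XsubC; apply: Hr; rewrite mem_head.
by apply: IHr => y yr; apply: Hr; rewrite inE yr orbT.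
Qed.

End Valuation.

(** Pigeonhole: there are finitely many remainders modulo P, so two powers of X share one. *)
Lemma dvdp_Xn_sub_Xm (F : finFieldType) (P : {poly F}) : P != 0 ->
  exists a b, (a < b)%N /\ P %| 'X^a - 'X^b.
Proof.
move=> P0; pose T := {ffun 'I_(size P) -> F}.
pose f (k : 'I_#|T|.+1) : T := [ffun i => ('X^k %% P)`_(nat_of_ord i)].
have /injectivePn[a [b ab fab]] : ~~ injectiveb f.
  by apply/injectiveP => /leq_card; rewrite card_ord ltnn.
have Eab : 'X^a %% P = 'X^b %% P.
  apply/polyP => i; have [iP|Pi] := ltnP i (size P).
    by move/ffunP: fab => /(_ (Ordinal iP)); rewrite !ffunE.
  by rewrite !nth_default // (leq_trans _ Pi) // ltnW // ltn_modp.
have D (c d : nat) : 'X^c %% P = 'X^d %% P -> P %| 'X^c - 'X^d.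
  by move=> E; rewrite /dvdp modpD modpN E subrr.
have [lt_ab|lt_ba|/val_inj E] := ltngtP a b.
- by exists a, b; split; last exact: D.
- by exists b, a; split; last exact: D.
- by rewrite E eqxx in ab.
Qed.

Lemma intr_lift_Fp (p : nat) (H : {poly 'F_p}) :
  exists L : {poly int}, map_poly intr L = H.
Proof.
exists (\poly_(i < size H) (nat_of_ord H`_i)%:Z); apply/polyP => i.
rewrite coef_map coef_poly; case: ltnP => [_|Hi]; first exact: natr_Zp.
by rewrite nth_default.
Qed.

(** * Torsion of residues and powers of polynomials close to 1 *)

Section Arithmetic.
Variables (p : nat) (C : closedFieldType) (v : C -> option rat).
Variable iota : {rmorphism rat -> C}.
Hypotheses (p_pr : prime p) (vV : is_valuation v).
Hypothesis vQ : forall r : rat, r != 0 -> v (iota r) = Some (padic_val p r).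
Hypothesis vD : forall (x : C) (N : rat), exists y,
  (exists P : {poly rat}, P != 0 /\ root (map_poly iota P) y) /\
  vle (Some N) (v (x - y)).

Local Notation vge := (vge v).
Local Notation vfin := (vfin v).
Local Notation ge := (ge v).
Local Notation near := (near v).
Local Notation "F ^C" := (map_poly iota F) : ring_scope.
Let vF := vge_filtration vV.
Let gF := ge_filtration vV.

Lemma val_iota_p : vfin (iota p%:R) = 1.
Proof.
have p0 : p%:R != 0 :> rat by rewrite pnatr_eq0 -lt0n prime_gt0.
rewrite vfinE vQ //= /padic_val -[p%:R]/((p : int)%:~R) numq_int denq_int /=.
by rewrite logn1 logn_prime // eqxx.
Qed.

Lemma vge_p : vge 1 p%:R.
Proof. by have := vge_val vV (iota p%:R); rewrite val_iota_p rmorph_nat. Qed.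

Lemma iota_p_neq0 : iota p%:R != 0.
Proof. by rewrite fmorph_eq0 pnatr_eq0 -lt0n prime_gt0. Qed.

Lemma primitive_root (P : {poly rat}) y : P != 0 -> root P^C y ->
  exists2 z : {poly int}, zcontents z = 1 & root (map_poly intr z) y.
Proof.
move=> P0 Py; have [q [a a0 PE]] := rat_poly_scale P.
have q0 : q != 0 by apply: contraNneq P0 => q0; rewrite PE q0 rmorph0 scaler0.
exists (zprimitive q); first by rewrite zcontents_primitive q0.
move: Py; rewrite PE {1}(zpolyEprim q) !map_polyZ /= scalerA.
rewrite rootZ; last first.
  by rewrite mulf_neq0 // fmorph_eq0 ?invr_eq0 ?intr_eq0 ?zcontents_eq0.
by rewrite -map_poly_comp (eq_map_poly (g := intr)) // => k /=; rewrite rmorph_int.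
Qed.

(* The residue of [y] is nonzero and algebraic over F_p, hence a root of unity. *)
Lemma algebraic_unit_torsion (P : {poly rat}) y :
  P != 0 -> root P^C y -> y != 0 -> vfin y = 0 ->
  exists2 N, (0 < N)%N & vge 1 (y ^+ N - 1).
Proof.
move=> P0 Py y0 vy; have [z z1 zy] := primitive_root P0 Py.
have zp0 : map_poly intr z != 0 :> {poly 'F_p}.
  apply/eqP => zp0; have : (p %| zcontents z)%Z.
    rewrite dvdz_contents; apply/polyOverP => i.
    by rewrite [_ \in _](dvdz_pcharf (pchar_Fp p_pr)) -coef_map zp0 coef0.
  by rewrite z1 dvdz1 absz_nat; case: eqP p_pr => // ->.
have [a [b [lt_ab /dvdpP[H HE]]]] := dvdp_Xn_sub_Xm zp0.
have [L LE] := intr_lift_Fp H.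
(* All coefficients of [D] are divisible by p, while its value at y is y^a - y^b because z(y) =
   0. *)
pose D := 'X^a - 'X^b - L * z.
have Dy : vge 1 (map_poly intr D).[y].
  rewrite horner_coef; apply: (fil_sum vF) => i _; rewrite coef_map /=.
  have : (p %| D`_i)%Z.
    rewrite (dvdz_pcharf (pchar_Fp p_pr)) -coef_map /D !rmorphB rmorphM /=.
    by rewrite !map_polyXn LE HE subrr coef0.
  move=> /dvdzP[k ->]; rewrite intrM -[1]addr0.
  apply: (filM vF); last by apply: (filX0 vF); apply/(vgeE vV); rewrite ?vy.
  by rewrite -[1]add0r; apply: (filM vF); [apply: fil_int vF _ | apply: vge_p].
exists (b - a)%N; first by rewrite subn_gt0.
have E : (map_poly intr D).[y] = - y ^+ a * (y ^+ (b - a) - 1).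
  rewrite /D !rmorphB rmorphM /= !map_polyXn !hornerE (rootP zy) mulr0 subr0.
  by rewrite mulrBr mulr1 opprK mulNr -exprD subnKC ?(ltnW lt_ab) // addrC.
have ya0 : - y ^+ a != 0 by rewrite oppr_eq0 expf_neq0.
rewrite -(mulKf ya0 (_ - _)) -E -[1]add0r; apply: (filM vF) => //.
apply/(vgeE vV); rewrite ?invr_eq0 //.
by rewrite vfinV // vfinN // vfinX // vy mulr0 oppr0.
Qed.

Lemma torsion z : z != 0 -> exists N (c : rat),
  [/\ (0 < N)%N, c != 0 & vge 1 (iota c * z ^+ N - 1)].
Proof.
(* [b] clears the denominator of v(z), so z^b has the integer value [a] and p^(-a) z^b is a unit,
   later replaced by a close algebraic number. *)
move=> z0; pose b := `|denq (vfin z)|%N; pose a := numq (vfin z).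
pose c : rat := p%:R ^ (- a).
have p0 : p%:R != 0 :> rat by rewrite pnatr_eq0 -lt0n prime_gt0.
have c0 : c != 0 by rewrite expfz_eq0 (negPf p0) andbF.
have ic0 : iota c != 0 by rewrite fmorph_eq0.
have b0 : (0 < b)%N by rewrite absz_gt0 denq_neq0.
pose u := iota c * z ^+ b.
have u0 : u != 0 by rewrite mulf_neq0 ?expf_neq0.
have vu : vfin u = 0.
  rewrite vfinM ?expf_neq0 // vfinX // fmorphXz vfinXz ?iota_p_neq0 // val_iota_p.
  have bE : (denq (vfin z))%:~R = b%:R :> rat by rewrite -absz_denq.
  by rewrite mulrNz mulr1 numqE bE; ring.
have [y [[P [P0 Py]] uy]] := vD u 1.
have yu : vge 1 (y / u - 1).
  have -> : y / u - 1 = - ((u - y) * u^-1) by field.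
  apply: (filN vF); rewrite -[1]addr0; apply: (filM vF) => //.
  by apply/(vgeE vV); rewrite ?invr_eq0 // vfinV // vu oppr0.
have [yu0 vyu] := val_unit vV ltr01 yu.
have y0 : y != 0 by apply: contraNneq yu0 => ->; rewrite mul0r.
have vy : vfin y = 0 by rewrite -(divfK u0 y) vfinM // vyu vu addr0.
have uy1 : vge 1 (u / y - 1).
  have -> : u / y - 1 = (u - y) * y^-1 by field.
  rewrite -[1]addr0; apply: (filM vF) => //.
  by apply/(vgeE vV); rewrite ?invr_eq0 // vfinV // vy oppr0.
have [N N0 yN] := algebraic_unit_torsion P0 Py y0 vy.
exists (b * N)%N, (c ^+ N); split; rewrite ?muln_gt0 ?b0 ?expf_neq0 //.
rewrite rmorphXn exprM -exprMn -/u -(divfK y0 u) exprMn.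
by apply: (filM1 vF ltr01) => //; apply: (filX1 vF).
Qed.

(** [torsion] brings a power of F(a) close to 1 up to a rational factor; further p-th powers reach
    any precision [M]. *)
Lemma near_power a d (F : {poly rat}) M : near a d F^C ->
  exists N (c : rat),
    [/\ (0 < N)%N, c != 0 & ge a d M ((c *: F ^+ N)^C - 1)].
Proof.
move=> [Fa0 [e e0 He]]; have [N [c [N0 c0 Hc]]] := torsion Fa0.
pose e1 := Num.min 1 e.
have e1_gt0 : 0 < e1 by rewrite lt_min ltr01 e0.
have W1 : ge a d e1 ((c *: F ^+ N)^C - 1).
  have -> : (c *: F ^+ N)^C =
      (iota c * F^C.[a] ^+ N)%:P * (F^C.[a]^-1 *: F^C) ^+ N.
    rewrite map_polyZ rmorphXn /= mul_polyC exprZn scalerA -mulrA -exprMn.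
    by rewrite mulfV // expr1n mulr1.
  apply: (filM1 (gF a d)) => //.
    rewrite -polyCB; apply: (geC vV).
    by apply: (filW vF _ Hc); rewrite ge_min lexx.
  apply: (filX1 (gF a d)) => //.
  by apply: (filW (gF a d) _ He); rewrite ge_min lexx orbT.
have gp : ge a d 1 p%:R by rewrite -polyC_natr; apply: (geC vV); apply: vge_p.
have [t Ht] := filXpn (gF a d) M gp e1_gt0 W1.
exists (N * p ^ t)%N, (c ^+ (p ^ t)).
split; rewrite ?muln_gt0 ?N0 ?expn_gt0 ?prime_gt0 ?expf_neq0 //.
by rewrite exprM -exprZn rmorphXn.
Qed.

Lemma val_scaled_power (z : C) M N (c : rat) : z != 0 -> c != 0 -> 0 < M ->
  vge M (iota c * z ^+ N - 1) -> N%:R * vfin z = - vfin (iota c).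
Proof.
move=> z0 c0 M0 /(val_unit vV M0)[_].
by rewrite vfinM ?expf_neq0 ?fmorph_eq0 // vfinX // => H; lra.
Qed.

(** * Key polynomials: least degree among those with a root in a ball *)

Definition key_poly (a : C) (d : rat) (f : {poly rat}) (x : C) : Prop :=
  [/\ f != 0, root f^C x, vge d (x - a) &
      forall g : {poly rat}, g != 0 -> (size g < size f)%N ->
        forall z, root g^C z -> ~ vge d (z - a)].

(** Density of the algebraic numbers gives a rational polynomial with a root in the ball; descend on
    its degree. *)
Lemma key_poly_exists a d : exists f x, key_poly a d f x.
Proof.
have [y [[P [P0 Py]] ay]] := vD a d.
have {ay} : vge d (y - a) by rewrite -opprB; apply: (filN vF).
move: {2}(size P) (leqnn (size P)) => n; elim: n => [|n IHn] in P y P0 Py *.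
  by rewrite leqn0 size_poly_eq0 (negPf P0).
move=> Pn ya; have [[g [z [g0 gP gz za]]]|H] := classic (exists (g : {poly rat}) z,
    [/\ g != 0, (size g < size P)%N, root g^C z & vge d (z - a)]).
  by apply: (IHn g z) => //; rewrite -ltnS (leq_trans gP).
by exists P, y; split=> // g g0 gP z gz za; apply: H; exists g, z.
Qed.

Lemma modp_horner (f g : {poly rat}) z : root f^C z -> (g %% f)^C.[z] = g^C.[z].
Proof.
move=> fz; rewrite {2}(divp_eq g f) rmorphD rmorphM /= hornerD hornerM.
by rewrite (rootP fz) mulr0 add0r.
Qed.

Lemma key_poly_near a d f x (g : {poly rat}) : key_poly a d f x -> g != 0 ->
  (size g < size f)%N -> near x d g^C.
Proof.
move=> [f0 fx xa fmin] g0 gf; apply: (near_no_root vV); first by rewrite map_poly_eq0.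
move=> z gz zx; apply: (fmin g g0 gf z gz).
by rewrite -(subrK x z) -addrA; apply: (filD vF).
Qed.

(* The valuation of Q(x) = Q[X]/(f) given by x is the only one coming from a root of f.
   A polynomial of degree < deg f taking a small value at x is small on the whole
   ball, hence has small coefficients, hence small values at the other roots. *)
Lemma key_poly_root_val a d f x x' g : key_poly a d f x -> root f^C x' ->
  v g^C.[x'] = v g^C.[x].
Proof.
move=> Kf fx'; have [f0 fx xa fmin] := Kf.
rewrite -(modp_horner g fx) -(modp_horner g fx').
have [->|h0] := eqVneq (g %% f) 0; first by rewrite rmorph0 !horner0.
have hf : (size (g %% f)%R < size f)%N by rewrite ltn_modp.
set h := g %% f in h0 hf *; have nh := key_poly_near Kf h0 hf.
have hx0 : h^C.[x] != 0 by case: nh.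
pose y := Num.min d (vfin (x' - x)).
have le_yd : y <= d by rewrite ge_min lexx.
(* [M] exceeds by 1 the loss incurred when the ball around x is enlarged from d to [y] so as to
   contain x'. *)
pose M := 1 + (size f)%:R * (d - y).
have M0 : 0 < M.
  by rewrite ltr_wpDr ?ltr01 // mulr_ge0 ?ler0n ?subr_ge0.
have [N [c [N0 c0 HW]]] := near_power M nh.
(* [E] agrees with [W] at the roots of f and, by its degree, is as small on the whole ball as at
   x. *)
set W := c *: h ^+ N - 1; pose E := W %% f.
have WE : W^C = (c *: h ^+ N)^C - 1 by rewrite rmorphB rmorph1.
have Wz z : W^C.[z] = iota c * h^C.[z] ^+ N - 1.
  by rewrite WE hornerD hornerN hornerC map_polyZ hornerZ rmorphXn /= horner_exp.
have Wx : vge M W^C.[x].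
  by apply: (ge_horner vV (d := d)); rewrite ?WE // subrr; apply: (vge0 vV).
have gE : ge x d M E^C.
  have [->|E0] := eqVneq E 0; first by rewrite rmorph0; apply: (fil0 (gF x d)).
  have nE : near x d E^C by apply: (key_poly_near Kf) => //; rewrite ltn_modp.
  apply: (filW (gF x d) _ (near_ge vV nE)).
  by apply/(vgeE vV); [case: nE | rewrite modp_horner].
have Wx' : vge 1 W^C.[x'].
  rewrite -(modp_horner W fx') -/E; apply: (ge_horner vV (a := x) (d := y)).
    have -> : 1 = M - (size f)%:R * (d - y) by rewrite /M; ring.
    by apply: (ge_enlarge vV) => //; rewrite size_map_poly ltnW // ltn_modp.
  by apply: (filW vF _ (vge_val vV _)); rewrite ge_min lexx orbT.
rewrite !Wz in Wx Wx'.
have [chx' _] := val_unit vV ltr01 Wx'.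
have hx'0 : h^C.[x'] != 0.
  by apply: contraNneq chx' => ->; rewrite expr0n eqn0Ngt N0 mulr0.
(* Both v(h(x)) and v(h(x')) are forced to be -v(c)/N. *)
have H1 := val_scaled_power hx0 c0 M0 Wx.
have H2 := val_scaled_power hx'0 c0 ltr01 Wx'.
have N0' : N%:R != 0 :> rat by rewrite pnatr_eq0 -lt0n.
by rewrite !(v_some vV) //; congr Some; apply: (mulfI N0'); rewrite H1 H2.
Qed.

(** By [coef_comp_XaddC] the coefficients are values of rational polynomials at x' and x, so
    [key_poly_root_val] applies to each. *)
Lemma key_poly_ge a d f x x' g d' c : key_poly a d f x -> root f^C x' ->
  ge x' d' c g^C <-> ge x d' c g^C.
Proof.
move=> Kf fx'; split=> H i; have := H i;
  by rewrite !coef_comp_XaddC !nderivn_map !vge_vle (key_poly_root_val _ Kf fx').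
Qed.

(** As x0 is at least as close to b as each z, v(x0 - z) >= v(b - z): no factor has smaller value on
    the ball around x0 than at b. *)
Lemma ge_prod_XsubC (x0 b : C) d (r : seq C) :
  (forall z, z \in r -> b - z != 0 /\ vfin (b - z) <= vfin (b - x0)) ->
  b - x0 != 0 -> vfin (b - x0) <= d ->
  (\prod_(z <- r) ('X - z%:P)).[b] != 0 /\
  ge x0 d (vfin (\prod_(z <- r) ('X - z%:P)).[b]) (\prod_(z <- r) ('X - z%:P)).
Proof.
move=> Hr bx0 le_d; elim: r Hr => [|z r IHr] Hr.
  rewrite big_nil hornerC oner_neq0 (vfin1 vV); split=> //.
  exact: (fil1 (gF x0 d)).
have [bz le_z] := Hr z (mem_head _ _).
have [|p0 gp] := IHr; first by move=> y yr; apply: Hr; rewrite inE yr orbT.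
rewrite big_cons hornerM hornerXsubC mulf_neq0 // (vfinM vV) //; split=> //.
apply: (filM (gF x0 d)) => //; apply: (ge_XsubC vV); first exact: le_trans le_d.
have -> : x0 - z = (b - z) - (b - x0) by ring.
by apply: (filB vF); apply/(vgeE vV).
Qed.

(** Let x0 be the root of f nearest to b. On the ball around x0 the factor X - x0 has value d > v(b
    - x0), and the other factors lose nothing by [ge_prod_XsubC]. *)
Lemma key_poly_separated a d f x b d' : key_poly a d f x ->
  (forall z, root f^C z -> ~ vge (Num.min d d') (z - b)) ->
  near b d' f^C /\ exists2 c, vfin f^C.[b] < c & ge a d c f^C.
Proof.
move=> Kf Hb; have [f0 fx xa fmin] := Kf.
have fC0 : f^C != 0 by rewrite map_poly_eq0.
split.
  apply: (near_no_root vV) => // z /Hb Hz zb; apply: Hz.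
  by apply: (filW vF _ zb); rewrite ge_min lexx orbT.
have [r fE] := closed_field_poly_normal f^C; set k := lead_coef f^C in fE.
have k0 : k != 0 by rewrite lead_coef_eq0.
have rE z : (z \in r) = root f^C z by rewrite fE rootZ // root_prod_XsubC.
have Hr z : z \in r -> b - z != 0 /\ vfin (b - z) < d.
  rewrite rE => /Hb Hz; have bz : b - z != 0.
    rewrite subr_eq0; apply/eqP => bz; apply: Hz; rewrite bz subrr; apply: (vge0 vV).
  split=> //; rewrite ltNge; apply/negP => le_d; apply: Hz; rewrite -opprB.
  by apply: (filN vF); apply/(vgeE vV); rewrite // ge_min le_d.
have [|x0 x0r maxx0] := @seq_argmax _ r (fun z => vfin (b - z)).
  by apply/eqP => r0; move: fx; rewrite -rE r0.
have [bx0 lt_d] := Hr _ x0r.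
have [|//||p0 gp] := @ge_prod_XsubC x0 b d (rem x0 r).
- by move=> z /mem_rem zr; split; [case: (Hr z zr) | apply: maxx0].
- exact: ltW.
set P := \prod_(z <- _) _ in p0 gp.
have {fE} fE : f^C = k *: (('X - x0%:P) * P) by rewrite fE (big_rem x0).
have gx0 : ge x0 d (vfin k + (d + vfin P.[b])) f^C.
  rewrite fE; apply: (geZ vV); first exact: (vge_val vV).
  apply: (filM (gF x0 d)) => //; apply: (ge_XsubC vV) => //.
  by rewrite subrr; apply: (vge0 vV).
exists (vfin k + (d + vfin P.[b])).
  rewrite fE hornerZ hornerM hornerXsubC !(vfinM vV) ?mulf_neq0 //.
  by rewrite ltrD2l ltrD2r.
(* [key_poly_ge] moves the bound from x0 to the root x, which lies in the ball of a. *)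
rewrite rE in x0r; move/(key_poly_ge _ _ _ Kf x0r): gx0.
by apply: (ge_change vV); rewrite // -opprB; apply: (filN vF).
Qed.

(** * Runge approximation on finitely many balls *)

Section Balls.
Variables (I : finType) (alpha : I -> C) (d : I -> rat).
Local Notation geb i := (ge (alpha i) (d i)).
Local Notation nearb i := (near (alpha i) (d i)).

(* Successive minimization: f j is larger on the ball j than on all the others, so
   j is not among the balls where f j is minimal; a large power of f j reduces the
   choice of i to these balls. *)
Lemma isolating_poly (f : I -> {poly rat}) (S : {set I}) :
  (forall l j, l \in S -> j \in S -> l != j -> nearb l (f j)^C /\
     exists2 c, vfin (f j)^C.[alpha l] < c & geb j c (f j)^C) ->
  S != set0 ->
  exists (i : I) (U : {poly rat}), [/\ i \in S, nearb i U^C &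
    forall l, l \in S -> l != i ->
      exists2 c, vfin U^C.[alpha i] < c & geb l c U^C].
Proof.
move: {2}#|S| (leqnn #|S|) => n; elim: n => [|n IHn] in S *.
  by rewrite leqn0 cards_eq0 => ->.
move=> Sn sep /set0Pn[j jS]; have [S1|] := eqVneq (S :\ j) set0.
  exists j, 1; split=> //; first by rewrite rmorph1; apply: (nearC vV); rewrite oner_neq0.
  by move=> l lS lj; have := in_set0 l; rewrite -S1 !inE lj lS.
move=> S1; pose m l := vfin (f j)^C.[alpha l].
have [|l0] := @seq_argmax _ (enum (S :\ j)) (fun l => - m l).
  by apply: contraNneq S1 => E; apply/eqP/setP => l; rewrite -mem_enum E in_nil inE.
rewrite mem_enum => l0S min_l0; have {min_l0} min_l0 l : l \in S :\ j -> m l0 <= m l.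
  by rewrite -mem_enum => /min_l0; rewrite lerN2.
pose S' := [set l in S :\ j | m l == m l0].
have S'S l : l \in S' -> l \in S by rewrite !inE => /andP[/andP[]].
have [|||i [U [iS' nU gU]]] := IHn S'.
- rewrite -ltnS; apply: leq_trans Sn; apply: proper_card; apply/properP; split.
    by apply/subsetP.
  by exists j => //; rewrite !inE eqxx.
- by move=> l k lS' kS'; apply: sep; apply: S'S.
- by apply/set0Pn; exists l0; rewrite inE l0S eqxx.
have iS := S'S i iS'; have : i \in S :\ j by move: iS'; rewrite inE => /andP[].
rewrite !inE => /andP[ij _]; have mi : m i = m l0 by move: iS'; rewrite !inE => /andP[_ /eqP].
have [nfi _] := sep i j iS jS ij.
have vUN N : vfin (f j ^+ N * U)^C.[alpha i] = N%:R * m l0 + vfin U^C.[alpha i].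
  have [fi0 _] := nfi; have [Ui0 _] := nU.
  by rewrite rmorphM rmorphXn /= hornerM horner_exp (vfinM vV) ?expf_neq0 ?(vfinX vV) // -mi.
(* On [S'] the factor f_j^N is neutral and U gives the strict inequality; elsewhere f_j has larger
   value than on ball i, and a large N outweighs U. *)
have [N HN] : exists N, forall l, l \in S -> l != i ->
    exists2 c, N%:R * m l0 + vfin U^C.[alpha i] < c & geb l c (f j ^+ N * U)^C.
  apply: eventually_all => l.
  have [lS|] := boolP (l \in S); last by exists 0%N => k _.
  have [lS'|lS'] := boolP (l \in S').
    exists 0%N => N _ _ li; have [c lt_c gc] := gU l lS' li.
    exists (N%:R * m l0 + c); first by rewrite ltrD2l.
    move: lS'; rewrite !inE => /andP[/andP[lj _] /eqP ml].
    rewrite rmorphM rmorphXn; apply: (filM (gF _ _)) => //; apply: (filX (gF _ _)).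
    by rewrite -ml; apply: (near_ge vV); case: (sep l j lS jS lj).
  have [c1 lt_c1 gc1] : exists2 c1, m l0 < c1 & geb l c1 (f j)^C.
    have [->|lj] := eqVneq l j.
      by move: l0S; rewrite !inE => /andP[l0j l0S]; case: (sep l0 j l0S jS l0j).
    have lSj : l \in S :\ j by rewrite !inE lj.
    exists (m l); last by apply: (near_ge vV); case: (sep l j lS jS lj).
    by rewrite lt_neqAle min_l0 // andbT eq_sym; apply: contra lS'; rewrite inE lSj.
  have [c2 gc2] := ge_exists vV (alpha l) (d l) U^C.
  have [N0 HN0] := rat_archi ((vfin U^C.[alpha i] - c2) / (c1 - m l0)).
  exists N0 => N /HN0; rewrite ltr_pdivrMr ?subr_gt0 // => HN _ li.
  exists (N%:R * c1 + c2); first by lra.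
  by rewrite rmorphM rmorphXn; apply: (filM (gF _ _)) => //; apply: (filX (gF _ _)).
exists i, (f j ^+ N * U); split=> //.
  by rewrite rmorphM rmorphXn; apply: (nearM vV) => //; apply: (nearX vV).
by move=> l lS li; rewrite vUN; apply: HN.
Qed.

(** If a root z of f_j were that close to alpha_l, then, with ball j recentred at z by
    [key_poly_ge], one ball would contain the other and the bounds would be comparable. *)
Lemma incomparable_separated (f : I -> {poly rat}) (x : I -> C) l j :
  (forall i, key_poly (alpha i) (d i) (f i) (x i)) ->
  ~ (forall c (g : {poly rat}), geb j c g^C -> geb l c g^C) ->
  ~ (forall c (g : {poly rat}), geb l c g^C -> geb j c g^C) ->
  forall z, root (f j)^C z -> ~ vge (Num.min (d j) (d l)) (z - alpha l).
Proof.
move=> Kf Hjl Hlj z fz zl; have [_ fx xa _] := Kf j.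
have [le_jl|/ltW le_lj] := lerP (d j) (d l).
  apply: Hjl => c g gj; apply: (ge_change vV le_jl (a := z)).
    rewrite -opprB; apply: (filN vF); rewrite -[d j](_ : Num.min (d j) (d l) = _) //.
    by apply/min_idPl.
  by apply/(key_poly_ge g _ _ (Kf j) fz); apply: (ge_change vV (lexx _) xa).
apply: Hlj => c g gl; apply: (ge_change vV (lexx _) (a := x j)).
  by rewrite -opprB; apply: (filN vF).
apply/(key_poly_ge g _ _ (Kf j) fz); apply: (ge_change vV le_lj _ gl).
rewrite -[d l](_ : Num.min (d j) (d l) = _) //.
by apply/min_idPr.
Qed.

Lemma multiple_close_to_1 (q : {poly rat}) (S : {set I}) :
  (forall j, j \in S -> nearb j q^C) ->
  exists g : {poly rat}, q %| g /\ forall j, j \in S -> geb j 1 (g^C - 1).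
Proof.
have [f /fin_all_exists[x Kf]] := fin_all_exists (fun j => key_poly_exists (alpha j) (d j)).
move: {2}#|S| (leqnn #|S|) => n; elim: n => [|n IHn] in S *.
  rewrite leqn0 cards_eq0 => /eqP-> _; exists 0; split; first exact: dvdp0.
  by move=> j; rewrite in_set0.
move=> Sn nq; have IH i : i \in S -> exists g : {poly rat}, q %| g /\
    forall j, j \in S -> j != i -> geb j 1 (g^C - 1).
  move=> iS; have [||g [qg Hg]] := IHn (S :\ i).
  - by move: Sn; rewrite (cardsD1 i S) iS.
  - by move=> j; rewrite !inE => /andP[_]; apply: nq.
  - by exists g; split=> // j jS ji; apply: Hg; rewrite !inE ji.
(* Ball l is redundant when the bounds on ball j imply those on ball l. *)
have [[l [j [lS jS lj Hjl]]]|inc] := classic (exists l j, [/\ l \in S, j \in S, l != j &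
    forall c (g : {poly rat}), geb j c g^C -> geb l c g^C]).
  have [g [qg Hg]] := IH l lS; exists g; split=> // i iS.
  have [->|il] := eqVneq i l; last exact: Hg.
  have := Hjl 1 (g - 1); rewrite rmorphB rmorph1; apply.
  by apply: Hg => //; rewrite eq_sym.
have [->|S0] := eqVneq S set0.
  by exists 0; split; [exact: dvdp0 | move=> j; rewrite in_set0].
have [||i [U [iS nU gU]]] := @isolating_poly f S => //.
  move=> l j lS jS lj; apply: (key_poly_separated (Kf j)).
  apply: (incomparable_separated Kf) => H; apply: inc.
    by exists l, j.
  by exists j, l; rewrite eq_sym.
have [g [qg Hg]] := IH i iS; have nqi := nq i iS.
(* U has strictly larger value on the other balls, so a large [s] compensates for the value of q
   there. *)
have [s Hs] : exists s, forall l, l \in S -> l != i ->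
    geb l (vfin q^C.[alpha i] + s%:R * vfin U^C.[alpha i]) (q * U ^+ s)^C.
  apply: eventually_all => l.
  have [lS|] := boolP (l \in S); last by exists 0%N => k _.
  have [->|li] := eqVneq l i; first by exists 0%N => k _ _ /eqP.
  have [c1 lt_c1 gc1] := gU l lS li.
  have [c2 gc2] := ge_exists vV (alpha l) (d l) q^C.
  have [N0 HN0] := rat_archi ((vfin q^C.[alpha i] - c2) / (c1 - vfin U^C.[alpha i])).
  exists N0 => N /HN0; rewrite ltr_pdivrMr ?subr_gt0 // => HN _ _.
  apply: (filW (gF _ _) (d := c2 + N%:R * c1)); first by lra.
  by rewrite rmorphM rmorphXn; apply: (filM (gF _ _)) => //; apply: (filX (gF _ _)).
set F := q * U ^+ s in Hs.
have nF : nearb i F^C.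
  by rewrite rmorphM rmorphXn; apply: (nearM vV) => //; apply: (nearX vV).
have vFi : vfin F^C.[alpha i] = vfin q^C.[alpha i] + s%:R * vfin U^C.[alpha i].
  have [qi0 _] := nqi; have [Ui0 _] := nU.
  by rewrite rmorphM rmorphXn /= hornerM horner_exp (vfinM vV) ?expf_neq0 ?(vfinX vV).
have [b gb] := ge_exists vV (alpha i) (d i) (1 - g^C).
(* This makes the value of (1 - g)(1 - T) on ball i at least b + M >= 1. *)
pose M := Num.max 1 (1 - b); have M0 : 0 < M by rewrite lt_max ltr01.
have [N [c [N0 c0 HT]]] := near_power M nF.
have Fi0 : F^C.[alpha i] != 0 by case: nF.
have vc : N%:R * vfin F^C.[alpha i] = - vfin (iota c).
  apply: (val_scaled_power Fi0 c0 M0).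
  have := ge_horner vV (x := alpha i) HT; rewrite hornerD hornerN hornerC.
  by rewrite map_polyZ hornerZ rmorphXn /= horner_exp; apply; rewrite subrr; apply: (vge0 vV).
set T := c *: F ^+ N in HT.
exists (1 - (1 - g) * (1 - T)); split.
  have -> : 1 - (1 - g) * (1 - T) = g + (1 - g) * T by ring.
  apply: dvdp_add => //; apply: dvdp_mull; rewrite dvdpZr //.
  by rewrite -(prednK N0) exprS -mulrA dvdp_mulr.
have E : (1 - (1 - g) * (1 - T))^C - 1 = (g^C - 1) * (1 - T^C).
  by rewrite !(rmorphB, rmorphM, rmorph1) /=; ring.
move=> l lS; rewrite E; have [->|li] := eqVneq l i.
  apply: (filW (gF _ _) (d := b + M)).
    by have : 1 - b <= M; [rewrite le_max lexx orbT | lra].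
  by rewrite -mulrNN !opprB; apply: (filM (gF _ _)).
apply: (filW (gF _ _) (d := 1 + 0)); first by rewrite addr0.
apply: (filM (gF _ _)); first exact: Hg.
apply: (filB (gF _ _)); first exact: (fil1 (gF _ _)).
(* T is integral on ball l: v(c) + N v(F(alpha_i)) = 0 since T is close to 1 at alpha_i. *)
rewrite map_polyZ rmorphXn; have -> : 0 = vfin (iota c) + N%:R * vfin F^C.[alpha i].
  by rewrite vc subrr.
apply: (geZ vV); first exact: (vge_val vV).
by apply: (filX (gF _ _)); rewrite vFi; apply: Hs.
Qed.

End Balls.
End Arithmetic.

(* MathComp only makes [ratr] a ring morphism into a numFieldType. *)
Section RatrChar0.
Variable F : fieldType.
Hypothesis int_inj : forall k : int, k != 0 -> k%:~R != 0 :> F.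

(** [ratr] uses the reduced fraction; cross-multiplying integers allows any denominator, such as the
    product of two. *)
Lemma ratr_frac (x : rat) (n k : int) : k != 0 -> x * k%:~R = n%:~R ->
  ratr x = n%:~R / k%:~R :> F.
Proof.
move=> k0 xk; apply/eqP; rewrite /ratr eqr_div ?int_inj ?denq_neq0 // -!intrM.
apply/eqP; congr _%:~R; apply: (@intr_inj rat).
by rewrite !intrM -xk numqE; ring.
Qed.

Lemma ratr_zmod : zmod_morphism (ratr : rat -> F).
Proof.
move=> x y; have dx := denq_neq0 x; have dy := denq_neq0 y.
rewrite (@ratr_frac _ (numq x * denq y - numq y * denq x) (denq x * denq y)).
- rewrite /ratr intrB !intrM; field.
  by rewrite !int_inj.
- by rewrite mulf_neq0.
- by rewrite intrB !intrM !numqE; ring.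
Qed.

Lemma ratr_monoid : monoid_morphism (ratr : rat -> F).
Proof.
split=> [|x y]; first by rewrite (@ratr_frac _ 1 1) ?mulr1 // divr1.
have dx := denq_neq0 x; have dy := denq_neq0 y.
rewrite (@ratr_frac _ (numq x * numq y) (denq x * denq y)).
- rewrite /ratr !intrM; field.
  by rewrite !int_inj.
- by rewrite mulf_neq0.
- by rewrite !intrM !numqE; ring.
Qed.

Lemma ratr_rmorphism : exists f : {rmorphism rat -> F}, f = ratr :> (rat -> F).
Proof.
pose fa := GRing.isZmodMorphism.Build rat F ratr ratr_zmod.
pose fm := GRing.isMonoidMorphism.Build rat F ratr ratr_monoid.
pose f : {rmorphism rat -> F} := HB.pack (ratr : rat -> F) fa fm.
by exists f.
Qed.

End RatrChar0.

(** * Membership in R, with infinite delta included *)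

Section PolynomialOverring.
Variables (C : closedFieldType) (v : C -> option rat).
Variable iota : {rmorphism rat -> C}.
Hypothesis vV : is_valuation v.
Hypothesis iotaE : iota = ratr :> (rat -> C).

(** Membership in R is the case c = 0; the case c = 1 allows a division by p. *)
Definition zad_ge (a : C) (delta : option rat) (c : rat) (F : {poly C}) : Prop :=
  if delta is Some d then ge v a d c F else vge v c F.[a].

Lemma zad_filtration a delta : filtration (zad_ge a delta).
Proof.
case: delta => [d|]; first exact: ge_filtration.
exact: (filtration_comp (horner_eval a) (vge_filtration vV)).
Qed.

Lemma zad_ge_exists a delta F : exists c, zad_ge a delta c F.
Proof.
case: delta => [d|]; first exact: ge_exists.
by exists (vfin v F.[a]); apply: vge_val.
Qed.

Lemma zad_geC a delta c z : vge v c z -> zad_ge a delta c z%:P.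
Proof. by case: delta => [d|] Hz; [apply: geC | rewrite /= hornerC]. Qed.

Lemma in_Z_adE a delta (f : {poly rat}) :
  in_Z_ad v a delta f <-> zad_ge a delta 0 (map_poly iota f).
Proof.
rewrite iotaE; case: delta => [d|] //=; rewrite /ge /gauss /vge.
by split=> H i; have := H i; case: (v _) => //= x Hx; lra.
Qed.

Lemma zad_ge_horner a delta c F x : zad_ge a delta c F ->
  in_ball v a delta x -> vge v c F.[x].
Proof. by case: delta => [d|] /= H => [|->] //; apply: ge_horner H. Qed.

(* For [delta = None], a small ball around [a] avoids the roots of [q]. *)
Lemma finite_radius (q : {poly C}) a delta : q != 0 ->
  (forall z, root q z -> ~ in_ball v a delta z) ->
  exists d, near v a d q /\ (forall c F, ge v a d c F -> zad_ge a delta c F).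
Proof.
case: delta => [d|] q0 Hq.
  by exists d; split=> //; apply: (near_no_root vV q0).
have [r qE] := closed_field_poly_normal q.
have rE z : root q z = (z \in r).
  by rewrite qE rootZ ?lead_coef_eq0 // root_prod_XsubC.
have [d Hd] : exists d, forall z, z \in r -> vfin v (z - a) < d.
  have [->|/(seq_argmax (fun z => vfin v (z - a)))[y _ Hy]] := eqVneq r [::].
    by exists 0.
  exists (vfin v (y - a) + 1) => z /Hy; lra.
exists d; split=> [|c F HF]; last first.
  by apply: (ge_horner vV HF); rewrite subrr; apply: vge0.
apply: (near_no_root vV q0) => z qz.
have za : z - a != 0 by rewrite subr_eq0; apply/eqP; apply: Hq.
by move/(vgeE vV _ za); rewrite leNgt Hd // -rE.
Qed.

End PolynomialOverring.

(** * Maximality of Q and roots of q in the balls *)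

Theorem mainTheorem11 (p : nat) (C : closedFieldType) (v : C -> option rat)
  (m : nat) (alpha : 'I_m -> C) (delta : 'I_m -> option rat) (q : {poly rat}) :
  prime p -> IsCp p v ->
  (forall j, admissible v (alpha j) (delta j)) ->
  KrullDomain (R_of v alpha delta) ->
  irreducible_poly q ->
  (maximal_ideal_of (R_of v alpha delta)
       (fun phi => R_of v alpha delta phi /\ q %| phi)
   <-> (forall (j : 'I_m) (x : C), root (map_poly ratr q) x ->
          ~ in_ball v (alpha j) (delta j) x)).
Proof.
move=> p_pr [vV vQ _ vDense] adm _ q_irr; have [vz _ _] := vV.
(* v is finite on nonzero integers, so C has characteristic 0. *)
have int_inj (k : int) : k != 0 -> k%:~R != 0 :> C.
  move=> k0; apply/eqP => kC; have := vQ k%:~R; rewrite intr_eq0 => /(_ k0).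
  by rewrite /ratr numq_int denq_int divr1 kC (vz 0).2.
have [iota iotaE] := ratr_rmorphism int_inj.
have RE f : R_of v alpha delta f <->
    forall j, zad_ge v (alpha j) (delta j) 0 (map_poly iota f).
  by split=> H j; apply/(in_Z_adE v iotaE).
rewrite -iotaE in vQ *.
have vD (x : C) (N : rat) : exists y,
    (exists P : {poly rat}, P != 0 /\ root (map_poly iota P) y) /\
    vle (Some N) (v (x - y)).
  have [y [[P HP] xy]] := vDense x N; exists y; split=> //; exists P.
  by rewrite iotaE.
pose zF j := zad_filtration vV (alpha j) (delta j).
have R0 : R_of v alpha delta 0.
  by apply/RE => j; rewrite rmorph0; apply: (fil0 (zF j)).
have R1 : R_of v alpha delta 1.
  by apply/RE => j; rewrite rmorph1; apply: (fil1 (zF j)).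
have RN f : R_of v alpha delta f -> R_of v alpha delta (- f).
  by move=> /RE Rf; apply/RE => j; rewrite rmorphN; apply: (filN (zF j)).
have RD f g : R_of v alpha delta f -> R_of v alpha delta g -> R_of v alpha delta (f + g).
  by move=> /RE Rf /RE Rg; apply/RE => j; rewrite rmorphD; apply: (filD (zF j)).
have RM f g : R_of v alpha delta f -> R_of v alpha delta g -> R_of v alpha delta (f * g).
  move=> /RE Rf /RE Rg; apply/RE => j; rewrite rmorphM -(addr0 0).
  by apply: (filM (zF j)).
have p0 : p%:R != 0 :> rat by rewrite pnatr_eq0 -lt0n prime_gt0.
have vp : vge v 1 p%:R := vge_p p_pr vV vQ.
have zp j : zad_ge v (alpha j) (delta j) 1 (map_poly iota p%:R).
  by rewrite rmorph_nat -polyC_natr; apply: zad_geC.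
have Rp : R_of v alpha delta p%:R.
  by apply/RE => j; apply: (filW (zF j) _ (zp j)); rewrite ler01.
have q1 : (1 < size q)%N by case: q_irr.
have q0 : q != 0 by rewrite -size_poly_gt0 ltnW.
have qC0 : map_poly iota q != 0 by rewrite map_poly_eq0.
have q_ndvd1 (c : rat) : c != 0 -> ~~ (q %| c%:P).
  move=> c0; apply/negP => /dvdp_leq; rewrite polyC_eq0 c0 size_polyC c0 => /(_ isT).
  by rewrite leqNgt q1.
have vF := vge_filtration vV.
split.
  move=> [_ _ Qmax] j x qx xB.
  (* [J] contains Q and p but not 1, whereas p is not in Q. *)
  pose J f := R_of v alpha delta f /\
    exists2 e : rat, 0 < e & vge v e (map_poly iota f).[x].
  have Rx f : R_of v alpha delta f -> vge v 0 (map_poly iota f).[x].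
    by move=> /RE/(_ j) Rf; apply: (zad_ge_horner vV Rf xB).
  have [|f [Rf qf]|JQ|RJ] := Qmax J.
  - split=> [f []|||f [Rf [e e0 fe]]|f g Rf [Rg [e e0 ge]]] //.
    + split=> //; exists 1 => //; rewrite rmorph0 horner0; exact: (fil0 vF).
    + move=> f g [Rf [e e0 fe]] [Rg [e' e'0 ge']]; split; first exact: RD.
      exists (Num.min e e'); first by rewrite lt_min e0.
      rewrite rmorphD hornerD; apply: (filD vF).
        by apply: (filW vF _ fe); rewrite ge_min lexx.
      by apply: (filW vF _ ge'); rewrite ge_min lexx orbT.
    + split; first exact: RN.
      by exists e => //; rewrite rmorphN hornerN; apply: (filN vF).
    + split; first exact: RM.
      exists e => //; rewrite rmorphM hornerM -(add0r e).
      by apply: (filM vF) => //; apply: Rx.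
  - split=> //; exists 1 => //; rewrite -(divpK qf) rmorphM hornerM (rootP qx) mulr0.
    exact: (fil0 vF).
  - have [|_] := JQ p%:R; last by rewrite -polyC_natr; apply/negP; apply: q_ndvd1.
    by split=> //; exists 1 => //; rewrite rmorph_nat -polyC_natr hornerC.
  - have [_ [e e0]] := RJ 1 R1; rewrite rmorph1 hornerC.
    by move/(vgeE vV _ (oner_neq0 C)); rewrite (vfin1 vV) leNgt e0.
move=> Hq.
(* Each ball or point is replaced by a ball of finite radius still free of roots of q. *)
have [d Hd] := fin_all_exists (fun j => finite_radius vV qC0 (Hq j)).
have [g [qg Hg]] := multiple_close_to_1 p_pr vV vQ vD (S := setT) (fun j _ => (Hd j).1).
have Hg1 j : zad_ge v (alpha j) (delta j) 1 (map_poly iota g - 1).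
  by apply: (Hd j).2; apply: Hg; rewrite inE.
have Rg : R_of v alpha delta g.
  by apply/RE => j; apply: (fil_unit (zF j) ltr01).
(* [r] inverts p modulo Q; it lies in R because 1 - g has value at least 1 for every j. *)
pose r := p%:R^-1 *: (1 - g).
have prg : p%:R * r + g = 1.
  by rewrite -polyC_natr mul_polyC scalerA mulfV // scale1r subrK.
have vpV : vge v (-1) (iota p%:R^-1).
  have := vge_val vV (iota p%:R)^-1.
  by rewrite (vfinV vV) ?(iota_p_neq0 iota p_pr) // (val_iota_p p_pr vQ) fmorphV.
have Rr : R_of v alpha delta r.
  apply/RE => j; rewrite map_polyZ -mul_polyC -(addNr 1); apply: (filM (zF j)).
    exact: zad_geC.
  by rewrite rmorphB rmorph1 -opprB; apply: (filN (zF j)).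
have Rpn f : exists n, R_of v alpha delta (p%:R ^+ n * f).
  suff [n Hn] : exists n, forall j,
      zad_ge v (alpha j) (delta j) 0 (map_poly iota (p%:R ^+ n * f)).
    by exists n; apply/RE.
  apply: eventually_all => j; have [c fc] := zad_ge_exists vV (alpha j) (delta j) (map_poly iota f).
  have [n Hn] := rat_archi (- c); exists n => k /Hn lt_ck.
  apply: (filW (zF j) (d := k%:R * 1 + c)); first by lra.
  rewrite rmorphM rmorphXn; apply: (filM (zF j)) => //.
  exact: (filX (zF j)).
split.
- split=> [f []||f h [Rf qf] [Rh qh]|f [Rf qf]|f h Rf [Rh qh]] //.
  + by split; [apply: RD | apply: dvdp_add].
  + by split; [apply: RN | rewrite dvdpNr].
  + by split; [apply: RM | apply: dvdp_mull].
- exists 1; split=> // -[_]; apply/negP; exact: (q_ndvd1 1 (oner_neq0 _)).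
- move=> J [JR J0 JD JN JM] QJ.
  have [[f [Jf qf]]|Hn] := classic (exists f, J f /\ ~~ (q %| f)); last first.
    left=> f Jf; split; first exact: JR.
    by apply/negPn/negP => qf; apply: Hn; exists f.
  right; suff J1 : J 1 by move=> h Rh; rewrite -[h]mulr1; apply: JM.
  (* The Bezout relation in Q[X], with denominators cleared by powers of p, puts a power of p in
     J. *)
  have /Bezout_eq1_coprimepP[[a b] /= ab1] : coprimep q f.
    by rewrite irreducible_poly_coprime.
  have [na Ra] := Rpn (a * q); have [nb Rb] := Rpn b.
  have Rpk k : R_of v alpha delta (p%:R ^+ k).
    by elim: k => [|k IHk] //; rewrite exprS; apply: RM.
  have Jpn : J (p%:R ^+ (na + nb)).
    rewrite -[X in J X]mulr1 -[X in _ * X]ab1 mulrDr; apply: JD.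
      rewrite addnC exprD -mulrA; apply: QJ; split; first by apply: RM.
      by do 3!apply: dvdp_mull; rewrite dvdpp.
    by rewrite mulrA exprD -(mulrA _ _ b); apply: JM => //; apply: RM.
  (* p^n = p^(n+1) r + p^n g with g in Q lowers the exponent until 1 is in J. *)
  elim: (na + nb)%N Jpn => [|n IHn] // Jpn; apply: IHn.
  rewrite -[X in J X]mulr1 -[X in _ * X]prg mulrDr mulrA -exprSr; apply: JD.
    by rewrite mulrC; apply: JM.
  by apply: JM => //; apply: QJ.
Qed.
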